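(* Let $\mathbb{F}$ be a field, let $\mathbb{V}$ be an $n$-dimensional vector space over $\mathbb{F}$ with a basis $b_1,\dots,b_n$, and let $(\cdot,\cdot)$ be the symmetric nondegenerate bilinear form on $\mathbb{V}$ with $(b_i,b_j)=\delta_{ij}$. Let $\mathbb{A}$ be the ternary Jordan algebra on $\mathbb{V}$ with product $[x,y,z]=(y,z)x+(x,z)y+(x,y)z$. Then $\mathbb{A}$ is simple, except if $\dim\mathbb{V}=2$ and $\mathrm{char}(\mathbb{F})=2$.
   Context: A ternary algebra with trilinear product $[\cdot,\cdot,\cdot]$ is a ternary Jordan algebra if (i) the product is totally commutative, i.e. invariant under all permutations of its three arguments; and (ii) for all pairs $x=(x_1,x_2)$, $y=(y_1,y_2)$ of elements, the linear map $D_{x,y}(z)=[[z,x_1,x_2],y_1,y_2]-[[z,y_1,y_2],x_1,x_2]$ is a derivation of the ternary product. An ideal of a ternary algebra $\mathcal{A}$ is a subspace $\mathcal{I}$ with $[\mathcal{I},\mathcal{A},\mathcal{A}]\subseteq\mathcal{I}$, $[\mathcal{A},\mathcal{I},\mathcal{A}]\subseteq\mathcal{I}$ and $[\mathcal{A},\mathcal{A},\mathcal{I}]\subseteq\mathcal{I}$. The algebra $\mathcal{A}$ is simple if $[\mathcal{A},\mathcal{A},\mathcal{A}]\ne 0$ and its only ideals are $0$ and $\mathcal{A}$.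
   Formalization: The cases dim V = 0, and dim V = 1 with char F = 3, are excluded, since there the product vanishes identically ([b,b,b] = 3b = 0) and A is not simple; the exception dim V = 2, char F = 2 is read as ''simple if and only if not this case''. *)

(* Defs.v *)
From HB Require Import structures.
From mathcomp Require Import all_boot all_order all_fingroup all_algebra ring.

Set Implicit Arguments.
Unset Strict Implicit.
Unset Printing Implicit Defensive.

Import GRing.Theory.
Local Open Scope ring_scope.

Record ternaryAlgebra (F : fieldType) (V : vectType F) := TernaryAlgebra {
  tprod :> V -> V -> V -> V;
  tprod_linear1 : forall y z, linear (fun x => tprod x y z);
  tprod_linear2 : forall x z, linear (fun y => tprod x y z);
  tprod_linear3 : forall x y, linear (fun z => tprod x y z)
}.

Section TernaryAlgebras.

Variables (F : fieldType) (V : vectType F).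
Implicit Type A : ternaryAlgebra V.

(* In 'I_3 the ring literals 0, 1, 2 are the three indices. *)
Definition totally_commutative A : Prop :=
  forall (s : 'S_3) (x : 'I_3 -> V),
    A (x (s 0)) (x (s 1)) (x (s 2)) = A (x 0) (x 1) (x 2).

Definition is_derivation A (D : V -> V) : Prop :=
  linear D /\
  forall x y z, D (A x y z) = A (D x) y z + A x (D y) z + A x y (D z).

Definition jordan_D A (x y : V * V) (z : V) : V :=
  A (A z x.1 x.2) y.1 y.2 - A (A z y.1 y.2) x.1 x.2.

Record ternaryJordan := TernaryJordan {
  tj_algebra :> ternaryAlgebra V;
  tj_comm : totally_commutative tj_algebra;
  tj_derivation : forall x y, is_derivation tj_algebra (jordan_D tj_algebra x y)
}.

Definition is_ideal A (I : {vspace V}) : Prop :=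
  forall x y z, x \in I -> [/\ A x y z \in I, A y x z \in I & A y z x \in I].

(* [A, A, A] is the span of all products, so it is nonzero exactly when some
   product is. *)
Definition is_simple A : Prop :=
  (exists x y z, A x y z != 0) /\
  forall I : {vspace V}, is_ideal A I -> I = 0%VS \/ I = fullv.

End TernaryAlgebras.

Section FormAlgebra.

Variables (F : fieldType) (V : vectType F) (form : {symmetric V}).

Definition form_tprod (x y z : V) : V :=
  form y z *: x + form x z *: y + form x y *: z.

Lemma symmetric_formC (x y : V) : form x y = form y x.
Proof. by rewrite hermC /= expr0 mul1r. Qed.

Lemma form_tprodC12 x y z : form_tprod y x z = form_tprod x y z.
Proof.
by rewrite /form_tprod (symmetric_formC y x) [form x z *: y + _]addrC.
Qed.

Lemma form_tprodC23 x y z : form_tprod x z y = form_tprod x y z.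
Proof. by rewrite /form_tprod (symmetric_formC z y) addrAC. Qed.

Lemma eq_linear_forms (u v : V) :
  (forall f : V -> F, {morph f : x y / x + y} ->
     (forall a, {morph f : x / a *: x >-> a * x}) -> {morph f : x / - x} ->
     f u = f v) -> u = v.
Proof.
move=> fE; rewrite (coord_vbasis (memvf u)) (coord_vbasis (memvf v)).
apply: eq_bigr => i _; congr (_ *: _).
by apply: fE => [x y|a x|x]; rewrite (linearD, linearZ, linearN).
Qed.

Lemma form_tprod_linear1 y z : linear (fun x => form_tprod x y z).
Proof.
move=> a u v; rewrite /form_tprod !linearPl /=.
by apply: eq_linear_forms => f fD fZ fN; rewrite !(fD, fZ); ring.
Qed.

Lemma form_tprod_linear2 x z : linear (fun y => form_tprod x y z).
Proof.
by move=> a u v; rewrite !(form_tprodC12 _ x); exact: form_tprod_linear1.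
Qed.

Lemma form_tprod_linear3 x y : linear (fun z => form_tprod x y z).
Proof.
by move=> a u v; rewrite -!(form_tprodC23 x y); exact: form_tprod_linear2.
Qed.

Definition form_ternaryAlgebra : ternaryAlgebra V :=
  TernaryAlgebra form_tprod_linear1 form_tprod_linear2 form_tprod_linear3.

Lemma form_totally_commutative : totally_commutative form_ternaryAlgebra.
Proof.
move=> s x /=.
have tri (i : 'I_3) : [\/ i = 0, i = 1 | i = 2].
  case: i => [[|[|[|//]]] ?];
    [apply: Or31|apply: Or32|apply: Or33]; exact: val_inj.
have neq (i j : 'I_3) : i != j -> s i != s j by rewrite (inj_eq perm_inj).
move: (neq 0 1 isT) (neq 0 2 isT) (neq 1 2 isT).
case: (tri (s 0)) => ->; case: (tri (s 1)) => -> //;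
  case: (tri (s 2)) => -> // _ _ _.
- by rewrite form_tprodC23.
- by rewrite form_tprodC12.
- by rewrite form_tprodC23 form_tprodC12.
- by rewrite form_tprodC12 form_tprodC23.
- by rewrite form_tprodC12 form_tprodC23 form_tprodC12.
Qed.

Local Notation D := (jordan_D form_ternaryAlgebra).

Lemma form_jordan_D_linear x y : linear (D x y).
Proof.
move=> a u v; rewrite /jordan_D !tprod_linear1.
by apply: eq_linear_forms => f fD fZ fN; rewrite !(fD, fZ, fN); ring.
Qed.

Lemma form_jordan_D_skew x y u v : form (D x y u) v = - form u (D x y v).
Proof.
case: x y => [x1 x2] [y1 y2]; rewrite /jordan_D /= /form_tprod.
rewrite !(linearBl, linearBr, linearDl, linearDr, linearZl_LR, linearZr_LR) /=.
have C := symmetric_formC.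
rewrite !(C x1 u, C x2 u, C y1 u, C y2 u, C x1 v, C x2 v, C y1 v, C y2 v).
rewrite !(C v u, C y1 x1, C y1 x2, C y2 x1, C y2 x2, C y2 y1, C x2 x1).
ring.
Qed.

Lemma form_jordan_derivation x y : is_derivation form_ternaryAlgebra (D x y).
Proof.
split=> [|u v w]; first exact: form_jordan_D_linear.
have Dlin := form_jordan_D_linear x y; have Dskew := form_jordan_D_skew x y.
move: (D x y) Dlin Dskew => d Dlin Dskew /=; rewrite /form_tprod.
have dD a b : d (a + b) = d a + d b by rewrite -[a]scale1r Dlin !scale1r.
have d0 : d 0 = 0 by apply: (addIr (d 0)); rewrite -dD !add0r.
have dZ a b : d (a *: b) = a *: d b by rewrite -[a *: b]addr0 Dlin d0 addr0.
rewrite !dD !dZ !Dskew.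
by apply: eq_linear_forms => f fD fZ fN; rewrite !(fD, fZ, fN); ring.
Qed.

Definition form_ternaryJordan : ternaryJordan V :=
  TernaryJordan form_totally_commutative form_jordan_derivation.

End FormAlgebra.

(* Main.v *)
Require Import Defs.
From mathcomp Require Import all_boot all_order all_fingroup all_algebra.

Set Implicit Arguments.
Unset Strict Implicit.
Unset Printing Implicit Defensive.

Local Open Scope ring_scope.

(** Everything is read off the multiplication table of an orthonormal basis:
    [b_i, b_j, b_j] = b_i for i <> j, and [x, b_i, b_i] = x + 2 (x, b_i) b_i.

    In dimension at least 2 the first identity makes the product nonzero; in
    dimension 1 the product is given by [b, b, b] = 3 b, which is nonzero
    outside characteristic 3.  The first identity also shows that an ideal
    containing a single basis vector is everything
    ([ideal_basis_vector_full]).  So it is enough to extract a basis vector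
    from a nonzero ideal I ([nonzero_ideal_basis_vector]).  Let x in I have
    (x, b_i) <> 0.  If 2 is invertible, [x, b_i, b_i] - x is a nonzero
    multiple of b_i.  If there are three distinct indices i, j, k, then
    u = [x, b_i, b_j] = (x, b_j) b_i + (x, b_i) b_j is in I, and
    [u, b_j, b_k] = (x, b_i) b_k.  In dimension 1 every nonzero subspace is
    everything.

    In dimension 2 and characteristic 2 the vector u = b_0 + b_1 is isotropic
    and its orthogonal is the line it spans; hence that line is a proper
    nonzero ideal ([isotropic_line_ideal]). *)

Import GRing.Theory.

Section OrthonormalBasis.

Variables (F : fieldType) (V : vectType F) (n : nat) (b : n.-tuple V).
Variable form : {symmetric V}.
Hypothesis b_basis : basis_of fullv b.
Hypothesis form_b : forall i j : 'I_n, form b`_i b`_j = (i == j)%:R.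

Local Notation A := (form_ternaryJordan form).

Lemma dim_fullv_basis : \dim {: V} = n.
Proof. by rewrite -(size_basis b_basis). Qed.

Lemma orthonormal_expansion x : x = \sum_(i < n) form x b`_i *: b`_i.
Proof.
rewrite {1}(coord_basis b_basis (memvf x)); apply: eq_bigr => i _.
congr (_ *: _); rewrite {2}(coord_basis b_basis (memvf x)).
rewrite linear_sumlz /= (bigD1 i) //= big1 => [|j /negPf ji].
  by rewrite linearZl_LR /= form_b eqxx addr0 mulr1.
by rewrite linearZl_LR /= form_b ji mulr0.
Qed.

Lemma form_neq0 x : x != 0 -> exists i : 'I_n, form x b`_i != 0.
Proof.
move=> x_neq0; apply/existsP; apply: contraNT x_neq0.
rewrite negb_exists => /forallP x_orth.
rewrite (orthonormal_expansion x) big1 // => i _.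
by move/negPn/eqP: (x_orth i) => ->; rewrite scale0r.
Qed.

Lemma tprod_basis_iij (i j : 'I_n) : i != j -> A b`_i b`_i b`_j = b`_j.
Proof.
move=> /negPf ij; rewrite /= /form_tprod !form_b ij eqxx.
by rewrite !scale0r !add0r scale1r.
Qed.

(** Multiplying b_k twice into any other basis vector returns that vector. *)
Lemma ideal_basis_vector_full (I : {vspace V}) (k : 'I_n) :
  is_ideal A I -> b`_k \in I -> I = fullv.
Proof.
move=> I_ideal bk; apply/eqP; rewrite eqEsubv subvf /=.
rewrite -(span_basis b_basis); apply/span_subvP => v.
case/(nthP 0) => m; rewrite size_tuple => m_lt <-.
rewrite -[m]/(val (Ordinal m_lt)).
have [<- //|km] := eqVneq k (Ordinal m_lt).
by rewrite -(tprod_basis_iij km); case: (I_ideal _ b`_k b`_(Ordinal m_lt) bk).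
Qed.

(** In dimension 2 and characteristic 2 this fails because [x, b_i, b_i] = x
    and [x, b_0, b_1] is x with its coordinates exchanged: both fix
    x = b_0 + b_1, and no coordinate is isolated. *)
Lemma nonzero_ideal_basis_vector (I : {vspace V}) :
  is_ideal A I -> I != 0%VS -> 2%:R != 0 :> F \/ (2 < n)%N ->
  exists k : 'I_n, b`_k \in I.
Proof.
move=> I_ideal; rewrite -vpick0 => /form_neq0[i].
set x := vpick I => xi_neq0; have xI : x \in I by exact: memv_pick.
have scaleI c v : c != 0 -> c *: v \in I -> v \in I.
  by move=> c_neq0 /(memvZ c^-1); rewrite scalerA mulVf // scale1r.
case=> [two_neq0|n_gt2].
  (* Subtracting x from [x, b_i, b_i] leaves 2 (x, b_i) b_i. *)
  exists i; apply: (scaleI (2%:R * form x b`_i)); first by rewrite mulf_neq0.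
  have [xii _ _] := I_ideal x b`_i b`_i xI.
  suff -> : 2%:R * form x b`_i *: b`_i = A x b`_i b`_i - x by exact: rpredB.
  rewrite /= /form_tprod form_b eqxx scale1r addrC -!addrA addKr.
  by rewrite -scalerDl mulr_natl mulr2n.
have /card_gt0P[j] : (0 < #|~: [set i]|)%N.
  by rewrite -(ltn_add2l #|[set i]|) cardsC cards1 card_ord ltnW.
rewrite !inE => ji.
have /card_gt0P[k] : (0 < #|~: [set i; j]|)%N.
  by rewrite -(ltn_add2l #|[set i; j]|) cardsC cards2 eq_sym ji card_ord.
rewrite !inE negb_or => /andP[ki kj].
have [ij [ik jk]] : i == j = false /\ i == k = false /\ j == k = false.
  by rewrite ![_ == k]eq_sym eq_sym !(negPf ji, negPf ki, negPf kj).
(* u = (x, b_j) b_i + (x, b_i) b_j has no b_k component, so multiplying by b_j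
   and b_k turns its b_j component into b_k and kills the other one. *)
have [uI _ _] := I_ideal x b`_i b`_j xI.
have [ujk _ _] := I_ideal _ b`_j b`_k uI.
exists k; apply: (scaleI _ _ xi_neq0); move: ujk.
rewrite /= /form_tprod !form_b ij scale0r add0r jk scale0r add0r.
rewrite !linearDl /= !linearZl_LR /= !form_b ij ik jk eqxx.
by rewrite !mulr0 mulr1 !add0r scale0r add0r.
Qed.

End OrthonormalBasis.

(** Modulo u, the product [u, y, z] is (u, z) y + (u, y) z, which pairs with u
    to 2 (u, y) (u, z) = 0; it is therefore orthogonal to u, and so lies on
    the line. *)
Lemma isotropic_line_ideal (F : fieldType) (V : vectType F)
    (form : {symmetric V}) (u : V) :
  2%:R = 0 :> F -> (forall v, form u v = 0 -> v \in <[u]>%VS) ->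
  is_ideal (form_ternaryJordan form) <[u]>%VS.
Proof.
move=> two0 u_orth x y z /vlineP[c ->] /=.
rewrite (form_tprodC23 _ y _ z) !(form_tprodC12 _ (c *: u) y).
suff uI : form_tprod form (c *: u) y z \in <[u]>%VS by [].
rewrite /form_tprod -addrA memvD ?memvZ ?memv_line //.
apply: u_orth; rewrite linearDr /= !linearZr_LR /= !linearZl_LR /=.
by rewrite -!mulrA [form u z * _]mulrC -mulr2n -mulr_natl two0 mul0r.
Qed.

Theorem theorem6 (F : fieldType) (V : vectType F) (n : nat) (b : n.-tuple V)
    (form : {symmetric V})
    (b_basis : basis_of fullv b)
    (form_nondeg : nondegenerate form)
    (form_b : forall i j : 'I_n, form b`_i b`_j = (i == j)%:R)
    (dim_gt0 : (0 < \dim {: V})%N)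
    (not_dim1_char3 : ~ (\dim {: V} = 1%N /\ 3%N \in [pchar F])) :
  is_simple (form_ternaryJordan form) <->
  ~ (\dim {: V} = 2%N /\ 2%N \in [pchar F]).
Proof.
have dimV := dim_fullv_basis b_basis.
split=> [[_ simpleA] [dim2 char2]|not_dim2_char2].
  have n2 : n = 2%N by rewrite -dimV.
  clear dimV; subst n; have two0 : 2%:R = 0 :> F := pcharf0 char2.
  have expand v : v = form v b`_0 *: b`_0 + form v b`_1 *: b`_1.
    rewrite {1}(orthonormal_expansion b_basis form_b v).
    by rewrite big_ord_recl big_ord1.
  have b00 := form_b ord0 ord0; have b01 := form_b ord0 (lift ord0 ord0).
  rewrite /= in b00 b01.
  pose u := b`_0 + b`_1.
  have u_neq0 : u != 0.
    apply: contra_eq_neq b00 => u0.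
    have : form b`_0 u = 0 by rewrite u0 linear0r.
    rewrite /u linearDr /= b01 addr0 => ->.
    by rewrite eq_sym oner_eq0.
  have u_orth v : form u v = 0 -> v \in <[u]>%VS.
    rewrite /u linearDl /= !(symmetric_formC _ _ v) => /eqP.
    (* In characteristic 2, opposite coordinates are equal coordinates. *)
    rewrite addr_eq0 -[- _]addr0 -(mulr0 (form v b`_1)) -two0 mulr_natr mulr2n.
    rewrite addKr => /eqP v01.
    by rewrite (expand v) v01 -scalerDr memvZ ?memv_line.
  case: (simpleA _ (isotropic_line_ideal two0 u_orth)) => line_eq.
    by move/eqP: line_eq; rewrite -dimv_eq0 dim_vline (negPf u_neq0).
  by move: dim2; rewrite -line_eq dim_vline u_neq0.
have basis_neq0 (i : 'I_n) : b`_i != 0.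
  apply: contra_eq_neq (form_b i i) => ->.
  by rewrite linear0r eqxx eq_sym oner_eq0.
split.
  have n_gt0 : (0 < n)%N by rewrite -dimV.
  pose i0 := Ordinal n_gt0.
  have [n_gt1|n_le1] := ltnP 1 n.
    exists b`_i0, b`_i0, b`_(Ordinal n_gt1).
    by rewrite tprod_basis_iij.
  exists b`_i0, b`_i0, b`_i0; rewrite /= /form_tprod (form_b i0 i0) eqxx.
  rewrite !scale1r -mulr2n -mulrSr -scaler_nat scaler_eq0 negb_or.
  rewrite (basis_neq0 i0) andbT.
  apply/eqP => three0; apply: not_dim1_char3; split.
    by apply/eqP; rewrite dimV eqn_leq n_le1.
  by rewrite inE /= three0 eqxx.
move=> I I_ideal; have [->|I_neq0] := eqVneq I 0%VS; [by left | right].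
have [n_le1|n_gt1] := leqP n 1.
  apply/eqP; rewrite eqEdim subvf dimV (leq_trans n_le1) //.
  by rewrite lt0n dimv_eq0.
have [|k bk] := nonzero_ideal_basis_vector b_basis form_b I_ideal I_neq0.
  have [two0|] := eqVneq (2%:R : F) 0; [right | by left].
  rewrite ltn_neqAle n_gt1 andbT; apply/eqP => n2; apply: not_dim2_char2.
  by rewrite dimV -n2 inE /= two0 eqxx.
exact: ideal_basis_vector_full I_ideal bk.
Qed.
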